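(* Let $F$ be a real quadratic field with discriminant $\Delta_F$, and let $\sigma,\sigma':F\to\mathbb{R}$ be its two real embeddings, sending $\sqrt{\Delta_F}$ to $\sqrt{\Delta_F}$ and to $-\sqrt{\Delta_F}$ respectively. Let $I=\mathbb{Z}+\mathbb{Z}f$ be a reduced fractional ideal of $F$, where $f\in F$ is the unique element with $I=\mathbb{Z}+\mathbb{Z}f$, $\sigma(f)>1$ and $-1<\sigma'(f)<0$. If $N(f-1/2)\le -3/4$, then $I$ is $1$-reduced.
   Context: $N(x)=\sigma(x)\sigma'(x)$ denotes the field norm of $x\in F$ over $\mathbb{Q}$. A fractional ideal $I$ of $F$ is called reduced if $1$ is minimal in $I$: that is, $1\in I$, and if $g\in I$ satisfies $|\sigma(g)|<1$ and $|\sigma'(g)|<1$ then $g=0$. Every reduced ideal of a real quadratic field can be written as $\mathbb{Z}+\mathbb{Z}f$ for a unique $f\in F$ with $\sigma(f)>1$ and $-1<\sigma'(f)<0$. For $u=(u_1,u_2)\in(\mathbb{R}_{>0})^2$ and $g\in F$ put $\|g\|_u=\sqrt{u_1^2\sigma(g)^2+u_2^2\sigma'(g)^2}$. The element $1$ is called primitive in $I$ if $1\in I$ and $1$ is not divisible in $I$ by any integer $d\ge 2$ (i.e. $1/d\notin I$ for all integers $d\ge2$). A fractional ideal $I$ is called $1$-reduced if $1$ is primitive in $I$ and there exists $u\in(\mathbb{R}_{>0})^2$ such that $\|1\|_u\le\|g\|_u$ for all $g\in I\setminus\{0\}$. *)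

(* Defs.v *)
From HB Require Import structures.
From mathcomp Require Import all_boot all_order all_algebra.
From mathcomp Require Import falgebra fieldext.
From mathcomp Require Import all_classical all_reals.

Set Implicit Arguments.
Unset Strict Implicit.
Unset Printing Implicit Defensive.

Import Order.TTheory GRing.Theory Num.Theory.
Local Open Scope classical_set_scope.
Local Open Scope ring_scope.

Section NumberField.
Variable F : fieldExtType rat.

Definition ring_of_integers : set F :=
  [set x | integralOver (intr : int -> F) x].

Definition field_trace (x : F) : rat :=
  \tr (passmx.mxof (vbasis {:F}) (vbasis {:F}) (amulr x)).

Definition integral_basis (w : (\dim {:F}).-tuple F) : Prop :=
  basis_of {:F} w /\
  ring_of_integers =
    [set x | exists c : 'I_(\dim {:F}) -> int, x = \sum_i (c i)%:~R * w`_i].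

(* The determinant does not depend on the integral basis, so this determines
   Delta. *)
Definition is_discriminant (Delta : int) : Prop :=
  exists2 w : (\dim {:F}).-tuple F, integral_basis w &
    Delta%:~R =
      \det (\matrix_(i < \dim {:F}, j < \dim {:F}) field_trace (w`_i * w`_j)) :> rat.

Definition fractional_ideal (I : set F) : Prop :=
  [/\ exists2 g, I g & g != 0,
      forall g h, I g -> I h -> I (g + h),
      forall a g, ring_of_integers a -> I g -> I (a * g) &
      exists2 d, ring_of_integers d /\ d != 0 &
        forall g, I g -> ring_of_integers (d * g)].

Definition ZplusZ (f : F) : set F :=
  [set g | exists a b : int, g = a%:~R + b%:~R * f].

Definition one_primitive (I : set F) : Prop :=
  I 1 /\ forall d : int, 2 <= d -> ~ I (d%:~R^-1).

End NumberField.

Section RealQuadratic.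
Variables (R : realType) (F : fieldExtType rat).
Variables (sigma sigma' : {rmorphism F -> R}).

Definition quad_norm (x : F) : R := sigma x * sigma' x.

Definition reduced (I : set F) : Prop :=
  [/\ fractional_ideal I, I 1 &
      forall g, I g -> `|sigma g| < 1 -> `|sigma' g| < 1 -> g = 0].

Definition unorm (u : R * R) (g : F) : R :=
  Num.sqrt (u.1 ^+ 2 * sigma g ^+ 2 + u.2 ^+ 2 * sigma' g ^+ 2).

Definition one_reduced (I : set F) : Prop :=
  [/\ fractional_ideal I, one_primitive I &
      exists u : R * R, [/\ 0 < u.1, 0 < u.2 &
        forall g, I g -> g != 0 -> unorm u 1 <= unorm u g]].

End RealQuadratic.

(* Main.v *)
Require Import Defs.
From HB Require Import structures.
From mathcomp Require Import all_boot all_order all_algebra.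
From mathcomp Require Import falgebra fieldext.
From mathcomp Require Import all_classical all_reals.
From mathcomp Require Import zify ring lra.

(** Write [p = sigma f - 1/2 > 0] and [q = 1/2 - sigma' f > 0], so that the
hypothesis on the norm reads [p * q >= 3/4].  The weights [u = (sqrt q, sqrt p)]
are those for which the orthogonal projection of [f] on [1] is exactly
[1/2 * 1].  On [g = a + b f] the squared norm is then a multiple of a binary
form whose middle coefficient equals its leading one:
[(p + q) * (a^2 + a b + (p q + 1/4) b^2)].
Since [p q + 1/4 >= 1], it dominates [(p + q) * (a^2 + a b + b^2)], and the
hexagonal form [a^2 + a b + b^2] is a positive integer at every nonzero integer
point ([hexagonal_form_ge1]).  So [p + q], the squared norm of [1], is minimal
([weighted_form_ge]).

Primitivity of [1] comes from the irrationality of [f]: the two embeddings of [f]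
have different signs, so [1/d = a + b f] forces [b = 0], and [1/d] is not an
integer ([one_primitive_ZplusZ]). *)

Set Implicit Arguments.
Unset Strict Implicit.
Unset Printing Implicit Defensive.

Import Order.TTheory GRing.Theory Num.Theory.
Local Open Scope classical_set_scope.
Local Open Scope ring_scope.

Lemma hexagonal_form_ge1 (a b : int) :
  (a != 0) || (b != 0) -> 1 <= a ^+ 2 + a * b + b ^+ 2.
Proof. by move=> ab0; rewrite !expr2; nia. Qed.

(** With [p = s - 1/2] and [q = 1/2 - t], the left-hand side of the conclusion
minus [(p + q) * (a^2 + a b + b^2)] is [(p + q) * (p q - 3/4) * b^2],
so the bound reduces to that for the hexagonal form. *)
Lemma weighted_form_ge (R : realFieldType) (s t : R) (a b : int) :
  2^-1 < s -> t < 2^-1 -> 3 / 4 <= (s - 2^-1) * (2^-1 - t) ->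
  (a != 0) || (b != 0) ->
  (2^-1 - t) + (s - 2^-1) <=
    (2^-1 - t) * (a%:~R + b%:~R * s) ^+ 2 +
    (s - 2^-1) * (a%:~R + b%:~R * t) ^+ 2.
Proof.
move=> s_gt t_lt st_ge /hexagonal_form_ge1.
rewrite -(ler_int R) rmorphD rmorphD rmorphM !rmorphXn /=.
move: (a%:~R : R) (b%:~R : R) => x y hex_ge1.
have sum_ge0 : 0 <= s - t by lra.
have hex_le := ler_wpM2l sum_ge0 hex_ge1.
have excess_ge0 : 0 <= (s - t) * ((s - 2^-1) * (2^-1 - t) - 3 / 4) * y ^+ 2.
  by apply: mulr_ge0 (sqr_ge0 y); apply: mulr_ge0 => //; rewrite subr_ge0.
have -> : (2^-1 - t) * (x + y * s) ^+ 2 + (s - 2^-1) * (x + y * t) ^+ 2 =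
    (s - t) * (x ^+ 2 + x * y + y ^+ 2) +
    (s - t) * ((s - 2^-1) * (2^-1 - t) - 3 / 4) * y ^+ 2 by field.
by lra.
Qed.

(** Two ring morphisms that differ at [f] keep [f] out of the prime field, so
that [1] and [f] are linearly independent. *)
Lemma one_primitive_ZplusZ (R : realFieldType) (F : fieldExtType rat)
    (sigma sigma' : {rmorphism F -> R}) (f : F) :
  sigma f != sigma' f -> one_primitive (ZplusZ f).
Proof.
move=> sf_neq; split; first by exists 1, 0; rewrite mul0r addr0.
move=> d d_ge2 [a [b dV_eq]].
have image (tau : {rmorphism F -> R}) :
    (d%:~R^-1 : R) = a%:~R + b%:~R * tau f.
  by rewrite -!(rmorph_int tau) -fmorphV dV_eq rmorphD rmorphM.
have d_neq0 : (d%:~R : R) != 0 by rewrite intr_eq0; lia.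
have b_eq0 : b = 0.
  have : (b%:~R : R) * (sigma f - sigma' f) = 0.
    by have := image sigma; rewrite (image sigma') mulrBr; lra.
  by move/eqP; rewrite mulf_eq0 subr_eq0 (negPf sf_neq) orbF intr_eq0 => /eqP.
have /eqP := mulVf d_neq0.
rewrite (image sigma) b_eq0 mul0r addr0 -intrM -[1]/(1%:~R) eqr_int => /eqP ad1.
by have [a_le0|a_gt0] := lerP a 0; nia.
Qed.

Theorem theorem1p1 (R : realType) (F : fieldExtType rat)
  (hF : \dim {:F} = 2%N)
  (Delta : int) (hDelta : is_discriminant F Delta) (hreal : 0 < Delta)
  (sqrtDelta : F) (hsqrt : sqrtDelta ^+ 2 = Delta%:~R)
  (sigma sigma' : {rmorphism F -> R})
  (hsigma : sigma sqrtDelta = Num.sqrt (Delta%:~R))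
  (hsigma' : sigma' sqrtDelta = - Num.sqrt (Delta%:~R))
  (I : set F) (hI : reduced sigma sigma' I)
  (f : F) (hIf : I = ZplusZ f)
  (hf : 1 < sigma f) (hf' : -1 < sigma' f < 0)
  (hN : quad_norm sigma sigma' (f - 2^-1) <= - (3 / 4)) :
  one_reduced sigma sigma' I.
Proof.
have [fracI _ _] := hI; have /andP[_ f'_lt0] := hf'.
split=> //.
  rewrite hIf; apply: (@one_primitive_ZplusZ _ _ sigma sigma').
  by rewrite gt_eqF //; lra.
have norm_ge : 3 / 4 <= (sigma f - 2^-1) * (2^-1 - sigma' f).
  move: hN; rewrite /quad_norm !rmorphB !fmorphV !rmorph_nat.
  by rewrite -[2^-1 - sigma' f]opprB mulrN; lra.
have p_gt0 : 0 < sigma f - 2^-1 by lra.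
have q_gt0 : 0 < 2^-1 - sigma' f by lra.
exists (Num.sqrt (2^-1 - sigma' f), Num.sqrt (sigma f - 2^-1)).
split; rewrite ?sqrtr_gt0 //= => g; rewrite hIf => -[a [b ->]] g_neq0.
have ab_neq0 : (a != 0) || (b != 0).
  apply: contraNT g_neq0; rewrite negb_or !negbK => /andP[/eqP-> /eqP->].
  by rewrite mul0r addr0.
rewrite /unorm ler_wsqrtr //= !sqr_sqrtr ?(ltW p_gt0) ?(ltW q_gt0) //.
rewrite !rmorph1 expr1n !mulr1 !rmorphD !rmorphM !rmorph_int.
by apply: weighted_form_ge => //; lra.
Qed.
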